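(* Consider the $q$-composite random key predistribution scheme on $n$ sensors with key pool size $P_n$ and key ring size $K_n$, where $q$ is a fixed positive integer and $q\le K_n\le P_n$. Let $p_s$ be the probability that the key rings of two sensors share at least $q$ keys. Suppose an adversary captures a uniformly random set of $m=m(n)\ge 1$ sensors and learns all keys in their key rings, and let $p_{\textnormal{compromised}}$ denote the probability that the secure link between two non-captured sensors is compromised, conditioned on these two sensors sharing at least $q$ keys. If $$m = o\!\left(\sqrt{\frac{P_n}{K_n^2}}\right)\quad\text{and}\quad K_n=\omega(1),$$ then $$p_{\textnormal{compromised}}\sim\left(\frac{mK_n}{P_n}\right)^q\qquad\text{and}\qquad \frac{p_{\textnormal{compromised}}}{p_s}\sim q!\left(\frac{m}{K_n}\right)^q .$$
   Context: In the $q$-composite scheme, each sensor independently receives $K_n$ distinct keys chosen uniformly at random among all $K_n$-subsets of a pool of $P_n$ keys; two sensors have a secure link iff their key rings share at least $q$ keys. The secure link between two non-captured sensors is compromised iff every key shared by their key rings belongs to the key ring of at least one captured sensor. Asymptotics are as $n\to\infty$: $x_n=o(y_n)$ means $x_n/y_n\to0$, $x_n=\omega(y_n)$ means $x_n/y_n\to\infty$, and $x_n\sim y_n$ means $x_n/y_n\to 1$. *)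

(* Defs.v *)
From mathcomp Require Import all_boot all_order all_algebra.
From mathcomp Require Import all_classical all_reals all_analysis.
Set Implicit Arguments. Unset Strict Implicit. Unset Printing Implicit Defensive.
Import Order.TTheory GRing.Theory Num.Theory.
Local Open Scope ring_scope.

Definition is_ring (P K : nat) (A : {set 'I_P}) : bool := #|A| == K.

Definition linked (P q : nat) (A B : {set 'I_P}) : bool := (q <= #|A :&: B|)%N.

Definition compromised (P m : nat) (A B : {set 'I_P}) (C : {ffun 'I_m -> {set 'I_P}}) : bool :=
  (A :&: B) \subset \bigcup_(i < m) C i.

Definition p_s (R : realType) (P K q : nat) : R :=
  (#|[set AB : {set 'I_P} * {set 'I_P} |
       [&& is_ring K AB.1, is_ring K AB.2 & linked q AB.1 AB.2]]|)%:R /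
  (#|[set AB : {set 'I_P} * {set 'I_P} | is_ring K AB.1 && is_ring K AB.2]|)%:R.

(* outcome: rings of the two non-captured sensors and of the m captured ones,
   all independent uniform K-subsets of the pool *)
Definition valid_outcome (P K m : nat)
  (x : ({set 'I_P} * {set 'I_P}) * {ffun 'I_m -> {set 'I_P}}) : bool :=
  [&& is_ring K x.1.1, is_ring K x.1.2 & [forall i, is_ring K (x.2 i)]].

Definition p_compromised (R : realType) (P K q m : nat) : R :=
  (#|[set x : ({set 'I_P} * {set 'I_P}) * {ffun 'I_m -> {set 'I_P}} | [&& valid_outcome K x, linked q x.1.1 x.1.2 &
                 compromised x.1.1 x.1.2 x.2]]|)%:R /
  (#|[set x : ({set 'I_P} * {set 'I_P}) * {ffun 'I_m -> {set 'I_P}} |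
        valid_outcome K x && linked q x.1.1 x.1.2]|)%:R.

(* Main.v *)
(* Fix the union [U] of the captured rings.  Counting a linked pair [(A, B)] with
   [A :&: B \subset U] through the [q]-subsets [S] of [U] gives at most
   'C(|U|, q) 'C(P-q, K-q)^2 pairs (choose [A] and [B] containing [S]) and at least
   'C(|U|, q) 'C(P-q, K-q) 'C(P-K, K-q) pairs (those with [A :&: B = S]); the two
   differ by a factor at least 1 - K^2/P.  Taking [U] to be the whole pool gives p_s,
   so p_compromised is the average of 'C(|U|, q) / 'C(P, q) up to such factors.
   Finally |U| <= m K always, and by a union bound |U| = m K except on a fraction at
   most d = m^2 K^2 / P of the families of captured rings; the hypothesis on m
   is exactly d -> 0. *)
Require Import Defs.
From mathcomp Require Import all_boot all_order all_algebra.
From mathcomp Require Import all_classical all_reals all_analysis.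
From mathcomp Require Import fintype finset ring zify.
Import Order.TTheory GRing.Theory Num.Theory.
Import numFieldNormedType.Exports.

Set Implicit Arguments.
Unset Strict Implicit.
Unset Printing Implicit Defensive.

Local Open Scope nat_scope.

(** * Counting pairs of rings whose common keys lie in a fixed set *)

Lemma card_meet_eq (T : finType) (X S : {set T}) (k : nat) :
  S \subset X -> #|S| <= k ->
  #|[set B : {set T} | (#|B| == k) && (B :&: X == S)]| = 'C(#|T| - #|X|, k - #|S|).
Proof.
move=> SX Sk; rewrite -(cardsC X) addKn -cards_draws.
have disjS (A : {set T}) : A \subset ~: X -> A :&: S = set0.
  by move=> /subsetP AX; apply/setP => x; rewrite !inE; apply/negP => /andP[/AX];
     rewrite inE => /negP nX /(subsetP SX).
(* Such a [B] is [S] together with an arbitrary part outside [X], so [A] maps to [S :|: A]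
   bijectively from the [(k - #|S|)]-subsets of [~: X] onto the sets counted. *)
pose D := [set A : {set T} | A \subset ~: X & #|A| == k - #|S|].
rewrite -/D -(card_in_imset (f := fun A => S :|: A) (D := D)); last first.
  rewrite /D => A B; rewrite !inE => /andP[/disjS AS _] /andP[/disjS BS _] e.
  have := congr1 (fun Z => Z :\: S) e.
  by rewrite !setDUl !setDv !set0U (setDidPl _) -?setI_eq0 ?AS // (setDidPl _) -?setI_eq0 ?BS.
apply: eq_card => B; rewrite !inE; apply/andP/imsetP.
- move=> [/eqP Bk /eqP BX]; exists (B :\: X).
    rewrite /D !inE setDE subsetIr /= -setDE.
    by rewrite -Bk -BX -(cardsID X B) addKn.
  by rewrite -BX setUC -{1}(setID B X) setUC.
- case=> A; rewrite !inE => /andP[AX /eqP cA] ->; split.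
    by rewrite cardsU setIC disjS // cards0 subn0 cA subnKC.
  rewrite setIUl (setIidPl SX); suff -> : A :&: X = set0 by rewrite setU0.
  by apply/eqP; rewrite setI_eq0 disjoints_subset.
Qed.

Lemma card_supersets (T : finType) (S : {set T}) (k : nat) :
  #|S| <= k ->
  #|[set B : {set T} | (#|B| == k) && (S \subset B)]| = 'C(#|T| - #|S|, k - #|S|).
Proof.
move=> Sk; rewrite -(card_meet_eq (X := S)) //.
by apply: eq_card => B; rewrite !inE setIC; congr (_ && _); apply/setIidPl/eqP.
Qed.

(** The set [U] is left free so that one count serves twice: the union of the captured rings gives
    the compromised linked pairs, the whole pool gives all linked pairs. *)
Definition link_pairs (T : finType) (k q : nat) (U : {set T}) :
    {set {set T} * {set T}} :=
  [set p : {set T} * {set T} | [&& #|p.1| == k, #|p.2| == k,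
     q <= #|p.1 :&: p.2| & p.1 :&: p.2 \subset U]].

Lemma card_bigcup_le (I T : finType) (P : pred I) (F : I -> {set T}) :
  #|\bigcup_(i | P i) F i| <= \sum_(i | P i) #|F i|.
Proof.
apply: (big_ind2 (fun (A : {set T}) n => #|A| <= n)); rewrite ?cards0 //.
by move=> A a B b Aa Bb; rewrite cardsU (leq_trans (leq_subr _ _)) // leq_add.
Qed.

Lemma ex_subset_card (T : finType) (q : nat) (A : {set T}) :
  q <= #|A| -> exists2 S : {set T}, S \subset A & #|S| = q.
Proof.
rewrite -bin_gt0 -cards_draws card_gt0 => /set0Pn[S].
by rewrite inE => /andP[SA /eqP]; exists S.
Qed.

Lemma card_link_pairs_le (T : finType) (k q : nat) (U : {set T}) : q <= k ->
  #|link_pairs k q U| <= 'C(#|U|, q) * 'C(#|T| - q, k - q) ^ 2.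
Proof.
move=> qk; pose D := [set S : {set T} | S \subset U & #|S| == q].
pose F (S : {set T}) := [set B : {set T} | (#|B| == k) && (S \subset B)].
(* A pair is covered once for each [q]-subset of its common keys, so summing over [S] may overcount;
   this is harmless for an upper bound. *)
apply: (@leq_trans #|\bigcup_(S in D) setX (F S) (F S)|).
  apply/subset_leq_card/subsetP => -[A B]; rewrite inE /= => /and4P[Ak Bk qAB ABU].
  have [S SAB Sq] := ex_subset_card qAB.
  apply/bigcupP; exists S; first by rewrite inE (subset_trans SAB) ?Sq /=.
  by move: SAB; rewrite subsetI !inE /= Ak Bk => /andP[-> ->].
apply: leq_trans (card_bigcup_le _ _) _.
rewrite -cards_draws -sum_nat_const; apply: leq_sum => S; rewrite inE => /andP[_ /eqP Sq].
by rewrite cardsX card_supersets Sq.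
Qed.

Lemma card_link_pairs_ge (T : finType) (k q : nat) (U : {set T}) : q <= k ->
  'C(#|U|, q) * ('C(#|T| - q, k - q) * 'C(#|T| - k, k - q)) <= #|link_pairs k q U|.
Proof.
move=> qk; pose D := [set S : {set T} | S \subset U & #|S| == q].
pose Lq := [set p : {set T} * {set T} | [&& #|p.1| == k, #|p.2| == k & p.1 :&: p.2 \in D]].
(* Only pairs with exactly [q] common keys are kept. Then [S] is determined by the pair, so the
   classes indexed by [S] are disjoint and their sizes add up exactly. *)
apply: (@leq_trans #|Lq|); last first.
  apply/subset_leq_card/subsetP => -[A B]; rewrite !inE /= => /and4P[-> -> -> /eqP ->] /=.
  by rewrite leqnn.
rewrite -cards_draws -[in X in _ <= X]sum1_card (partition_big (fun p => p.1 :&: p.2) (mem D)) /=; last first.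
  by move=> p; rewrite inE => /and3P[].
rewrite -sum_nat_const; apply: leq_sum => S SD.
have /andP[SU /eqP Sq] : (S \subset U) && (#|S| == q) by move: SD; rewrite inE.
(* The condition is reordered so that [A] is chosen first among the supersets of [S], then [B]
   meeting this [A] exactly in [S]; the number of choices for [B] does not depend on [A]. *)
rewrite (eq_bigl (fun p : {set T} * {set T} => ((#|p.1| == k) && (S \subset p.1)) &&
    ((#|p.2| == k) && (p.2 :&: p.1 == S)))); last first.
  move=> [A B]; rewrite !inE /= (setIC B A).
  case: (eqVneq (A :&: B) S) => [e|]; last by rewrite !andbF.
  have -> : S \subset A by rewrite -e subsetIl.
  by rewrite e SU Sq eqxx !andbT.
rewrite -(pair_big_dep (fun A : {set T} => (#|A| == k) && (S \subset A))
   (fun A B : {set T} => (#|B| == k) && (B :&: A == S)) (fun _ _ => 1)) /=.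
rewrite -Sq -card_supersets ?Sq // -sum_nat_const.
rewrite [in X in X <= _](eq_bigl (fun A : {set T} => (#|A| == k) && (S \subset A))); last first.
  by move=> A; rewrite inE.
apply: leq_sum => A /andP[/eqP Ak SA].
by rewrite sum1dep_card card_meet_eq ?Ak ?Sq.
Qed.

(** Delete [t] points one at a time: by Pascal's rule each deletion loses the [a]-subsets through
    the deleted point, at most ['C(n.-1, a.-1)] of them. *)
Lemma leq_bin_sub (n t a : nat) : 0 < a -> t <= n ->
  'C(n, a) <= 'C(n - t, a) + t * 'C(n.-1, a.-1).
Proof.
case: a => // a _; elim: t => [|t IH] tn; first by rewrite subn0 addn0.
apply: leq_trans (IH (ltnW tn)) _.
rewrite mulSn addnA leq_add2r.
have -> : n - t = (n - t.+1).+1 by rewrite subnS prednK // subn_gt0.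
by rewrite binS leq_add2l leq_bin2l //=; lia.
Qed.

(** * Families of captured rings and the rarity of overlaps among them *)

Definition key_rings (T : finType) (k m : nat) : {set {ffun 'I_m -> {set T}}} :=
  [set C : {ffun 'I_m -> {set T}} | [forall i, #|C i| == k]].

Lemma card_key_rings (T : finType) (k m : nat) :
  #|key_rings T k m| = 'C(#|T|, k) ^ m.
Proof.
rewrite -card_draws -[in RHS](card_ord m) -card_ffun_on; apply: eq_card => C.
rewrite inE; apply/forallP/ffun_onP => H i; move: (H i); by rewrite inE.
Qed.

(** The absorption identity; it expresses the probability [k / #|T|] that a ring contains a given
    key, with denominators cleared. *)
Lemma card_supersets1 (T : finType) (x : T) (k : nat) : 0 < k ->
  #|T| * #|[set A : {set T} | (#|A| == k) && (x \in A)]| = k * 'C(#|T|, k).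
Proof.
move=> k0; rewrite (eq_card (B := [set A : {set T} | (#|A| == k) && ([set x] \subset A)])).
  by rewrite card_supersets cards1 // subn1 subn1 -[in RHS](prednK k0) -mul_bin_diag.
by move=> A; rewrite !inE sub1set.
Qed.

(** The rings are independent: the families counted form a product set, in which coordinates [i] and
    [j] each contribute a factor [k / #|T|] and the others are unrestricted. *)
Lemma card_common_key (T : finType) (k m : nat) (i j : 'I_m) (x : T) :
  i != j -> 0 < k ->
  #|T| ^ 2 * #|[set C in key_rings T k m | (x \in C i) && (x \in C j)]| =
  k ^ 2 * 'C(#|T|, k) ^ m.
Proof.
move=> ij k0.
pose F (l : 'I_m) := [set A : {set T} | (#|A| == k) && ((l == i) || (l == j) ==> (x \in A))].
rewrite (eq_card (B := family (fun l => mem (F l)))); last first.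
  move=> C; rewrite !inE; apply/andP/familyP => [[/forallP Ck /andP[Ci Cj]] l|H].
    by rewrite inE Ck /=; apply/implyP => /orP[]/eqP ->.
  move: (H i) (H j); rewrite !inE !eqxx orbT /= => /andP[_ ->] /andP[_ ->]; split=> //.
  by apply/forallP => l; move: (H l); rewrite inE => /andP[].
rewrite card_family foldrE big_map big_enum /=.
rewrite (bigD1 i) //= (bigD1 j) 1?eq_sym //=.
have -> : 'C(#|T|, k) ^ m = 'C(#|T|, k) * ('C(#|T|, k) *
    \prod_(l < m | (l != i) && (l != j)) 'C(#|T|, k)).
  rewrite -[in LHS](card_ord m) -[LHS]prod_nat_const.
  by rewrite (bigD1 i) //= (bigD1 j) 1?eq_sym.
have Fi (l : 'I_m) : (l == i) || (l == j) -> #|T| * #|F l| = k * 'C(#|T|, k).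
  by move=> lij; rewrite -(card_supersets1 x) //; congr (_ * _); apply: eq_card => A; rewrite !inE lij.
have Fo (l : 'I_m) : (l != i) && (l != j) -> #|F l| = 'C(#|T|, k).
  rewrite -negb_or => /negbTE lij; rewrite -card_draws; apply: eq_card => A.
  by rewrite !inE lij andbT.
rewrite [in LHS](eq_bigr _ Fo).
have := Fi i; have := Fi j; rewrite !eqxx orbT => /(_ isT) ej /(_ isT) ei.
set c := bigop _ _ _.
transitivity ((#|T| * #|F i|) * (#|T| * #|F j|) * c); first by ring.
by rewrite ei ej; ring.
Qed.

Definition disjoint_rings (T : finType) (m : nat) (C : {ffun 'I_m -> {set T}}) : bool :=
  [forall i, forall j, (i != j) ==> [disjoint C i & C j]].

(** Union bound over two indices and a common key: at most [m ^ 2 * #|T|] events, each of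
    probability [(k / #|T|) ^ 2]. *)
Lemma card_not_disjoint_rings (T : finType) (k m : nat) : 0 < k ->
  #|T| * #|[set C in key_rings T k m | ~~ disjoint_rings C]| <=
  m ^ 2 * k ^ 2 * 'C(#|T|, k) ^ m.
Proof.
move=> k0; have [->//|T0] := posnP #|T|.
(* A second factor [#|T|] brings each event to the form of [card_common_key]. *)
rewrite -(leq_pmul2l T0) mulnA mulnn.
pose G (t : 'I_m * 'I_m * T) :=
  [set C in key_rings T k m | (t.2 \in C t.1.1) && (t.2 \in C t.1.2)].
have sub : [set C in key_rings T k m | ~~ disjoint_rings C] \subset
    \bigcup_(t : 'I_m * 'I_m * T | t.1.1 != t.1.2) G t.
  apply/subsetP => C; rewrite inE => /andP[Ck].
  rewrite negb_forall => /existsP[i]; rewrite negb_forall => /existsP[j].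
  rewrite negb_imply => /andP[ij]; rewrite -setI_eq0 => /set0Pn[x].
  rewrite inE => xij; apply/bigcupP; exists (i, j, x) => //=.
  by rewrite inE Ck.
apply: (@leq_trans (\sum_(t : 'I_m * 'I_m * T | t.1.1 != t.1.2) #|T| ^ 2 * #|G t|)).
  rewrite -big_distrr /= leq_mul2l; apply/orP; right.
  exact: leq_trans (subset_leq_card sub) (card_bigcup_le _ _).
apply: (@leq_trans (\sum_(t : 'I_m * 'I_m * T) k ^ 2 * 'C(#|T|, k) ^ m)).
  rewrite [in X in _ <= X](bigID (fun t : 'I_m * 'I_m * T => t.1.1 != t.1.2)) /=.
  apply: leq_trans (leq_addr _ _).
  by apply: leq_sum => t tij; rewrite card_common_key.
rewrite sum_nat_const card_prod card_prod !card_ord.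
by apply: eq_leq; ring.
Qed.

Lemma card_bigcup_rings_le (T : finType) (k m : nat) (C : {ffun 'I_m -> {set T}}) :
  C \in key_rings T k m -> #|\bigcup_i C i| <= m * k.
Proof.
rewrite inE => /forallP Ck; apply: leq_trans (card_bigcup_le _ _) _.
by rewrite (eq_bigr (fun=> k)) => [|i _]; rewrite ?sum_nat_const ?card_ord ?(eqP (Ck i)).
Qed.

Lemma card_bigcup_disjoint_rings (T : finType) (k m : nat) (C : {ffun 'I_m -> {set T}}) :
  C \in key_rings T k m -> disjoint_rings C -> #|\bigcup_i C i| = m * k.
Proof.
rewrite inE => /forallP Ck /forallP dC; rewrite -sum1_card partition_disjoint_bigcup.
  rewrite (eq_bigr (fun=> k)) => [|i _]; last by rewrite sum1_card (eqP (Ck i)).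
  by rewrite sum_nat_const card_ord.
by move=> i j; move: (dC i) => /forallP/(_ j)/implyP.
Qed.

(** * Averaging over the captured rings, and both probabilities as quotients of counts *)

Definition compromised_count (T : finType) (k q m : nat) : nat :=
  \sum_(C in key_rings T k m) #|link_pairs k q (\bigcup_i C i)|.

Lemma compromised_count_le (T : finType) (k q m : nat) : q <= k ->
  compromised_count T k q m <=
  'C(#|T|, k) ^ m * ('C(m * k, q) * 'C(#|T| - q, k - q) ^ 2).
Proof.
move=> qk; rewrite -card_key_rings -sum_nat_const; apply: leq_sum => C CK.
apply: leq_trans (card_link_pairs_le _ qk) _; rewrite leq_mul2r; apply/orP; right.
exact/leq_bin2l/card_bigcup_rings_le.
Qed.

(** Families with overlapping rings are discarded; in those that remain the union has exactly
    [m * k] keys. *)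
Lemma compromised_count_ge (T : finType) (k q m : nat) : q <= k ->
  #|[set C in key_rings T k m | disjoint_rings C]| *
    ('C(m * k, q) * ('C(#|T| - q, k - q) * 'C(#|T| - k, k - q))) <=
  compromised_count T k q m.
Proof.
move=> qk; rewrite /compromised_count (bigID (@disjoint_rings T m)) /=.
apply: leq_trans (leq_addr _ _).
rewrite -sum_nat_const.
rewrite [in X in X <= _](eq_bigl (fun C => (C \in key_rings T k m) && disjoint_rings C)); last first.
  by move=> C; rewrite inE.
apply: leq_sum => C /andP[CK dC].
by rewrite -(card_bigcup_disjoint_rings CK dC) card_link_pairs_ge.
Qed.

Lemma p_sE (R : realType) (P K q : nat) :
  p_s R P K q = ((#|link_pairs K q [set: 'I_P]|)%:R / ('C(P, K) ^ 2)%:R)%R :> R.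
Proof.
rewrite /p_s; congr (_%:R / _%:R)%R.
  by apply: eq_card => p; rewrite !inE subsetT andbT.
rewrite -mulnn -[in RHS](card_ord P) -card_draws -cardsX; apply: eq_card => p.
by rewrite !inE.
Qed.

(** Being linked does not involve the captured rings, so the conditioning event is a product set;
    the numerator is fibred over the captured family. *)
Lemma p_compromisedE (R : realType) (P K q m : nat) :
  p_compromised R P K q m =
  ((compromised_count 'I_P K q m)%:R /
   ('C(P, K) ^ m * #|link_pairs K q [set: 'I_P]|)%:R)%R :> R.
Proof.
rewrite /p_compromised; congr (_%:R / _%:R)%R.
  rewrite /compromised_count -[LHS]sum1dep_card.
  rewrite (eq_bigl (fun x : ({set 'I_P} * {set 'I_P}) * {ffun 'I_m -> {set 'I_P}} =>
    (x.2 \in key_rings 'I_P K m) && (x.1 \in link_pairs K q (\bigcup_i x.2 i)))); last first.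
    move=> [[A B] C]; rewrite !inE /valid_outcome /linked /compromised /is_ring /=.
    by case: (#|A| == K); case: (#|B| == K); case: (q <= _); rewrite ?andbF ?andbT.
  rewrite (reindex (fun y : {ffun 'I_m -> {set 'I_P}} * ({set 'I_P} * {set 'I_P}) => (y.2, y.1))) /=.
    rewrite -(pair_big_dep (fun C => C \in key_rings 'I_P K m)
      (fun C p => p \in link_pairs K q (\bigcup_i C i)) (fun _ _ => 1)) /=.
    by apply: eq_bigr => C _; rewrite sum1_card.
  by exists (fun x => (x.2, x.1)) => -[].
rewrite -[X in 'C(X, K)](card_ord P) -card_key_rings mulnC -cardsX.
apply: eq_card => -[[A B] C]; rewrite !inE /valid_outcome /linked /is_ring /= subsetT andbT.
by case: (#|A| == K); case: (#|B| == K); case: (q <= _); rewrite ?andbF ?andbT.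
Qed.

(** * Falling factorials and binomial coefficients *)

Lemma exp_subn_le_ffact (n q : nat) : (n - q) ^ q <= n ^_ q.
Proof.
elim: q n => [|q IH] n; first by rewrite expn0 ffactn0.
case: n => [|n]; first by rewrite sub0n exp0n.
rewrite ffactSS subSS expnS leq_mul //; lia.
Qed.

Lemma ffact_le_exp (n q : nat) : n ^_ q <= n ^ q.
Proof.
elim: q n => [|q IH] n; first by rewrite ffactn0.
case: n => [|n]; first by rewrite ffact0n.
rewrite ffactSS expnS leq_mul2l (leq_trans (IH n)) ?orbT //.
by case: (q) => [|r]; rewrite ?expn0 // leq_exp2r.
Qed.

(* A random (K-q)-subset of P-q points meets a given set of K-q points with
   probability at most K^2/P; stated without division. *)
Lemma bin_avoid (P K q : nat) : q <= K -> K <= P ->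
  P * 'C(P - q, K - q) <= P * 'C(P - K, K - q) + K ^ 2 * 'C(P - q, K - q).
Proof.
move=> qK KP; case: (posnP (K - q)) => [->|a0]; first by rewrite !bin0; lia.
set a := K - q in a0 *.
have -> : P - K = (P - q) - a by rewrite /a; lia.
set n := P - q.
have an : a <= n by rewrite /a /n; lia.
have h1 := leq_bin_sub a0 an.
have h2 : P * (a * 'C(n.-1, a.-1)) <= K ^ 2 * 'C(n, a).
  have n0 : 0 < n by lia.
  rewrite -(leq_pmul2l n0).
  have -> : n * (P * (a * 'C(n.-1, a.-1))) = P * a * (n * 'C(n.-1, a.-1)) by ring.
  rewrite mul_bin_diag prednK //.
  have -> : P * a * (a * 'C(n, a)) = (a * P) * a * 'C(n, a) by ring.
  have -> : n * (K ^ 2 * 'C(n, a)) = (K * n) * K * 'C(n, a) by ring.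
  rewrite leq_mul // leq_mul //; last by rewrite /a leq_subr.
  rewrite /a /n mulnBl mulnBr leq_sub2l //; nia.
apply: leq_trans (leq_mul (leqnn P) h1) _.
by rewrite mulnDr leq_add2l.
Qed.

(** Both sides count the pairs of a [q]-set inside a [K]-set. It serves to compare the denominator
    ['C(P, K) ^ 2] of [p_s] with the bounds on linked pairs. *)
Lemma bin_mul_bin (P K q : nat) : q <= K -> K <= P ->
  'C(P, K) * 'C(K, q) = 'C(P, q) * 'C(P - q, K - q).
Proof.
move=> qK KP.
have h1 := bin_fact KP; have h2 := bin_fact qK.
have h3 := bin_fact (leq_trans qK KP).
have h4 := bin_fact (leq_sub2r q KP).
have e : P - q - (K - q) = P - K by lia.
rewrite e in h4.
have f0 : 0 < q`! * (K - q)`! * (P - K)`! by rewrite !muln_gt0 !fact_gt0.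
apply/eqP; rewrite -(eqn_pmul2r f0); apply/eqP.
transitivity P`!.
  by rewrite -h1 -h2; ring.
by rewrite -h3 -h4; ring.
Qed.

Local Open Scope ring_scope.

(** * Explicit bounds for fixed parameters *)

Section Bounds.
Variable R : realType.

(** The relative error in replacing ['C(n, q)] by [n ^ q / q!]. *)
Definition bin_ratio (n q : nat) : R := 'C(n, q)%:R * q`!%:R / n%:R ^+ q.

Lemma bin_ratio_le1 (n q : nat) : bin_ratio n q <= 1.
Proof.
rewrite /bin_ratio -natrM bin_ffact -natrX.
(* If the denominator vanishes, the quotient is 0 by the convention on inverses. *)
have [->|n0] := posnP (n ^ q)%N; first by rewrite invr0 mulr0.
by rewrite ler_pdivrMr ?ltr0n // mul1r ler_nat ffact_le_exp.
Qed.

(** Each factor of [n ^_ q] is at least [n - q]. The bound is expressed through [K] rather than [n],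
    so that it is uniform over [n = K], [n = m * K] and [n = P]. *)
Lemma bin_ratio_ge (K n q : nat) : (0 < K)%N -> (q <= K)%N -> (K <= n)%N ->
  (1 - q%:R / K%:R) ^+ q <= bin_ratio n q.
Proof.
move=> K0 qK Kn; have n0 := leq_trans K0 Kn.
rewrite /bin_ratio -natrM bin_ffact ler_pdivlMr ?exprn_gt0 ?ltr0n // -exprMn.
apply: le_trans (_ : ((n - q) ^ q)%:R <= _); last by rewrite ler_nat exp_subn_le_ffact.
have K0' : (0 : R) < K%:R by rewrite ltr0n.
rewrite natrX; apply: lerXn2r; rewrite ?nnegrE ?ler0n //.
  by rewrite mulr_ge0 ?ler0n // subr_ge0 ler_pdivrMr // mul1r ler_nat.
rewrite natrB ?(leq_trans qK) // mulrBl mul1r lerD2l lerN2.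
by rewrite mulrAC ler_pdivlMr // ler_wpM2l // ler_nat.
Qed.


Section Estimates.
Variables P K q m : nat.
Hypotheses (q_gt0 : (0 < q)%N) (qK : (q <= K)%N) (KP : (K <= P)%N) (m_gt0 : (0 < m)%N).

Let K_gt0 : (0 < K)%N. Proof. exact: leq_trans q_gt0 qK. Qed.
Let P_gt0 : (0 < P)%N. Proof. exact: leq_trans K_gt0 KP. Qed.

(** Bounds the fraction of captured families with an overlap. As [m >= 1] it also dominates
    [K ^ 2 / P], the error in counting linked pairs, so one quantity controls both. *)
Let d : R := (m%:R * K%:R) ^+ 2 / P%:R.
Let v : R := (1 - q%:R / K%:R) ^+ q.
Let L : R := #|link_pairs K q [set: 'I_P]|%:R.
Let c : R := 'C(P - q, K - q)%:R.

Let c_gt0 : 0 < c. Proof. by rewrite ltr0n bin_gt0 leq_sub2r. Qed.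
Let CP_gt0 : 0 < 'C(P, q)%:R :> R. Proof. by rewrite ltr0n bin_gt0 (leq_trans qK). Qed.
Let N_gt0 : 0 < 'C(P, K)%:R :> R. Proof. by rewrite ltr0n bin_gt0. Qed.

Let avoid_ge : (1 - d) * c <= 'C(P - K, K - q)%:R.
Proof.
have P0 : (0 : R) < P%:R by rewrite ltr0n.
rewrite -(ler_pM2l P0) mulrA mulrBr mulr1 /d mulrCA mulfV ?mulr1 ?lt0r_neq0 //.
rewrite mulrBl lerBlDr -!natrM -natrX -!natrM -natrD ler_nat.
apply: leq_trans (bin_avoid qK KP) _; rewrite leq_add2l leq_mul2r leq_exp2r // leq_pmull ?orbT //.
Qed.

Let L_le : L <= 'C(P, q)%:R * c ^+ 2.
Proof.
have := card_link_pairs_le [set: 'I_P] qK; rewrite cardsT card_ord => h.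
by rewrite /L /c -natrX -natrM ler_nat.
Qed.

Let L_ge : 'C(P, q)%:R * ((1 - d) * c ^+ 2) <= L.
Proof.
have := card_link_pairs_ge [set: 'I_P] qK; rewrite cardsT card_ord => h.
apply: le_trans (_ : 'C(P, q)%:R * (c * 'C(P - K, K - q)%:R) <= _).
  by rewrite ler_wpM2l ?ler0n // expr2 mulrCA ler_wpM2l ?(ltW c_gt0).
by rewrite -!natrM ler_nat.
Qed.

Hypotheses (d_lt1 : d < 1) (v_gt0 : 0 < v).

Let u_gt0 : 0 < 1 - d. Proof. by rewrite subr_gt0. Qed.
Let L_gt0 : 0 < L.
Proof. by apply: lt_le_trans L_ge; rewrite !mulr_gt0 // exprn_gt0. Qed.

Let disjoint_rings_ge :
  'C(P, K)%:R ^+ m * (1 - d) <= #|[set C in key_rings 'I_P K m | disjoint_rings C]|%:R.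
Proof.
set D := (X in _ <= X).
have P0 : (0 : R) < P%:R by rewrite ltr0n.
have hB := card_not_disjoint_rings 'I_P m K_gt0; rewrite card_ord in hB.
set B := #|_| in hB.
have -> : D = 'C(P, K)%:R ^+ m - B%:R.
  apply/eqP; rewrite -subr_eq opprK -natrX -[P in X in _ == X]card_ord -card_key_rings /D -natrD.
  rewrite eqr_nat -(cardsID [set C | disjoint_rings C] (key_rings 'I_P K m)).
  by apply/eqP; congr (_ + _)%N; apply: eq_card => C; rewrite !inE // andbC.
rewrite mulrBr mulr1 lerD2l lerN2 -(ler_pM2l P0).
rewrite [leRHS](_ : _ = (m%:R * K%:R) ^+ 2 * 'C(P, K)%:R ^+ m); last first.
  by rewrite /d; field; rewrite gt_eqF.
by rewrite -!natrM -!natrX -!natrM ler_nat expnMn.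
Qed.

(** The value [p_compromised] would take if every captured union had [m * K] keys and the number of
    linked pairs inside [U] were exactly proportional to ['C(#|U|, q)]. *)
Let rho : R := 'C(m * K, q)%:R / 'C(P, q)%:R.

(** One factor [1 - d] is the share of disjoint families, the other comes from [avoid_ge]. Bounding
    the denominator by [L_le] costs no further factor. *)
Lemma p_compromised_ge : rho * (1 - d) ^+ 2 <= p_compromised R P K q m.
Proof.
have hS := compromised_count_ge 'I_P m qK; rewrite card_ord in hS.
rewrite p_compromisedE natrM natrX ler_pdivlMr ?mulr_gt0 ?exprn_gt0 //.
move: disjoint_rings_ge hS; set D := #|_| => hD hS.
apply: le_trans (_ : (D * ('C(m * K, q) * ('C(P - q, K - q) * 'C(P - K, K - q))))%:R <= _); last first.
  by rewrite ler_nat.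
rewrite !natrM -/c.
apply: le_trans (_ : ('C(P, K)%:R ^+ m * (1 - d)) * ('C(m * K, q)%:R * (c * ((1 - d) * c))) <= _).
  rewrite [leLHS](_ : _ = ('C(P, K)%:R ^+ m * ((1 - d) ^+ 2 * (rho * L)))); last by ring.
  rewrite [leRHS](_ : _ = ('C(P, K)%:R ^+ m * ((1 - d) ^+ 2 * ('C(m * K, q)%:R * c ^+ 2)))); last by ring.
  rewrite ler_wpM2l ?exprn_ge0 ?ler0n // ler_wpM2l ?sqr_ge0 //.
  apply: le_trans (ler_wpM2l _ L_le) _; first by rewrite divr_ge0 ?ler0n.
  by rewrite /rho mulrA divfK // gt_eqF.
apply: ler_pM => //; rewrite ?mulr_ge0 ?exprn_ge0 ?ler0n ?(ltW u_gt0) ?(ltW c_gt0) //.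
by rewrite ler_wpM2l ?ler0n // ler_wpM2l ?(ltW c_gt0).
Qed.

(** The numerator bound holds for every captured family without loss in [d]; the factor
    [1 / (1 - d)] comes only from bounding the denominator below by [L_ge]. *)
Lemma p_compromised_le : p_compromised R P K q m <= rho / (1 - d).
Proof.
have hS := compromised_count_le 'I_P m qK; rewrite card_ord in hS.
rewrite p_compromisedE natrM natrX ler_pdivrMr ?mulr_gt0 ?exprn_gt0 //.
apply: le_trans (_ : ('C(P, K) ^ m * ('C(m * K, q) * 'C(P - q, K - q) ^ 2))%:R <= _).
  by rewrite ler_nat.
rewrite !natrM !natrX -/c [in X in _ <= X]mulrCA ler_wpM2l ?exprn_ge0 ?ler0n //.
apply: le_trans (_ : rho / (1 - d) * ('C(P, q)%:R * ((1 - d) * c ^+ 2)) <= _); last first.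
  by rewrite ler_wpM2l // divr_ge0 ?divr_ge0 ?ler0n // ltW.
rewrite le_eqVlt; apply/orP; left; apply/eqP.
by rewrite /rho; field; rewrite !gt_eqF.
Qed.


(** Numerator and denominator both lie between [v] and 1. *)
Lemma ratio_bin_bounds (n : nat) : (K <= n)%N ->
  v <= bin_ratio n q / bin_ratio P q <= v^-1.
Proof.
move=> Kn.
have n1 := bin_ratio_le1 n q; have P1 := bin_ratio_le1 P q.
have n2 := bin_ratio_ge K_gt0 qK Kn; have P2 := bin_ratio_ge K_gt0 qK KP.
have P0 : 0 < bin_ratio P q by apply: lt_le_trans P2.
apply/andP; split.
  rewrite ler_pdivlMr //; apply: le_trans n2; rewrite ler_piMr // ltW //.
rewrite -[leRHS]mul1r; apply: ler_pM => //.
- exact: le_trans (ltW v_gt0) n2.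
- by rewrite invr_ge0 ltW.
- by rewrite lef_pV2.
Qed.

Lemma p_compromised_ratio_bounds :
  (1 - d) ^+ 2 * v <= p_compromised R P K q m / (m%:R * K%:R / P%:R) ^+ q
    <= (1 - d)^-1 * v^-1.
Proof.
have P0 : (0 : R) < P%:R by rewrite ltr0n.
have K0 : (0 : R) < K%:R by rewrite ltr0n.
have m0 : (0 : R) < m%:R by rewrite ltr0n.
have f0 : (0 : R) < q`!%:R by rewrite ltr0n fact_gt0.
have y0 : 0 < (m%:R * K%:R / P%:R : R) ^+ q.
  by rewrite exprn_gt0 // divr_gt0 // mulr_gt0.
have KmK : (K <= m * K)%N by rewrite leq_pmull.
have /andP[r1 r2] := ratio_bin_bounds KmK.
have rhoE : rho = bin_ratio (m * K) q / bin_ratio P q * (m%:R * K%:R / P%:R) ^+ q.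
  rewrite /rho /bin_ratio natrM !exprMn exprVn; field.
  by rewrite !gt_eqF // exprn_gt0.
rewrite ler_pdivlMr // ler_pdivrMr //; apply/andP; split.
  apply: le_trans p_compromised_ge; rewrite [leRHS]mulrC -[leLHS]mulrA rhoE.
  by rewrite ler_wpM2l ?sqr_ge0 // ler_wpM2r // ltW.
apply: le_trans p_compromised_le _; rewrite rhoE.
by rewrite [leLHS]mulrC -[leRHS]mulrA ler_wpM2l ?invr_ge0 ?(ltW u_gt0) // ler_wpM2r // ltW.
Qed.

Lemma p_s_ratio_bounds :
  (1 - d) * v ^+ 2 <= p_s R P K q * q`!%:R / (K%:R ^+ 2 / P%:R) ^+ q <= v^-1.
Proof.
have P0 : (0 : R) < P%:R by rewrite ltr0n.
have K0 : (0 : R) < K%:R by rewrite ltr0n.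
have f0 : (0 : R) < q`!%:R by rewrite ltr0n fact_gt0.
have CK0 : (0 : R) < 'C(K, q)%:R by rewrite ltr0n bin_gt0.
have /andP[r1 r2] := ratio_bin_bounds (leqnn K).
have k1 := bin_ratio_le1 K q; have k2 := bin_ratio_ge K_gt0 qK (leqnn K).
(* Substituting [bin_mul_bin] for ['C(P, K)] leaves three factors: the first lies in [[1 - d, 1]],
   the second in [[v, v^-1]], the third in [[v, 1]]. *)
have -> : p_s R P K q * q`!%:R / (K%:R ^+ 2 / P%:R) ^+ q =
    L / ('C(P, q)%:R * c ^+ 2) * (bin_ratio K q / bin_ratio P q) * bin_ratio K q.
  have e : 'C(P, K)%:R = 'C(P, q)%:R * c / 'C(K, q)%:R :> R.
    by rewrite -natrM -bin_mul_bin // natrM mulfK // gt_eqF.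
  rewrite p_sE -/L natrX e /bin_ratio.
  have -> : (K%:R ^+ 2 / P%:R : R) ^+ q = (K%:R ^+ q) ^+ 2 / P%:R ^+ q.
    by rewrite exprMn exprVn exprAC.
  field.
  by rewrite !gt_eqF ?exprn_gt0.
have V0 : 0 < 'C(P, q)%:R * c ^+ 2 by rewrite mulr_gt0 // exprn_gt0.
have l1 : L / ('C(P, q)%:R * c ^+ 2) <= 1 by rewrite ler_pdivrMr // mul1r.
have l2 : 1 - d <= L / ('C(P, q)%:R * c ^+ 2) by rewrite ler_pdivlMr // mulrCA.
have l0 := le_trans (ltW u_gt0) l2.
have r0 := le_trans (ltW v_gt0) r1.
have k0 := le_trans (ltW v_gt0) k2.
apply/andP; split.
  rewrite expr2 [leLHS]mulrA.
  have uv := ler_pM (ltW u_gt0) (ltW v_gt0) l2 r1.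
  exact: ler_pM (mulr_ge0 (ltW u_gt0) (ltW v_gt0)) (ltW v_gt0) uv k2.
apply: le_trans (_ : L / ('C(P, q)%:R * c ^+ 2) * (bin_ratio K q / bin_ratio P q) <= _).
  by rewrite ler_piMr // mulr_ge0.
by apply: le_trans r2; rewrite ler_piMl.
Qed.

End Estimates.

End Bounds.

(** * Passage to the limit *)

Unset Implicit Arguments.
Local Open Scope classical_set_scope.
Local Open Scope ring_scope.

Theorem theorem2 (R : realType) (q : nat) (P K m : nat -> nat) :
  (0 < q)%N ->
  (forall n, q <= K n <= P n)%N ->
  (forall n, 1 <= m n)%N ->
  (fun n => (m n)%:R / Num.sqrt ((P n)%:R / (K n)%:R ^+ 2) : R) @ \oo --> 0 ->
  (fun n => (K n)%:R : R) @ \oo --> +oo ->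
  ((fun n => p_compromised R (P n) (K n) q (m n) /
            ((m n)%:R * (K n)%:R / (P n)%:R) ^+ q) @ \oo --> (1 : R)) /\
  ((fun n => (p_compromised R (P n) (K n) q (m n) / p_s R (P n) (K n) q) /
            ((q`!)%:R * ((m n)%:R / (K n)%:R) ^+ q)) @ \oo --> (1 : R)).
Proof.
move=> q0 qKP m0 he hK.
have qK n : (q <= K n)%N by case/andP: (qKP n).
have KP n : (K n <= P n)%N by case/andP: (qKP n).
have K0 n : (0 : R) < (K n)%:R by rewrite ltr0n (leq_trans q0).
have P0 n : (0 : R) < (P n)%:R by rewrite ltr0n (leq_trans q0) ?(leq_trans (qK n)).
have M0 n : (0 : R) < (m n)%:R by rewrite ltr0n.
pose d n : R := ((m n)%:R * (K n)%:R) ^+ 2 / (P n)%:R.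
pose v n : R := (1 - q%:R / (K n)%:R) ^+ q.
(* [d] is the square of the sequence assumed to tend to 0. *)
have cd : d @ \oo --> (0 : R).
  pose e n : R := (m n)%:R / Num.sqrt ((P n)%:R / (K n)%:R ^+ 2).
  have h : (e \* e) @ \oo --> (0 * 0 : R) by exact: cvgM.
  suff <- : e \* e = d by rewrite mulr0 in h.
  apply/funext => n /=.
  rewrite -expr2 /e exprMn exprVn sqr_sqrtr ?divr_ge0 ?exprn_ge0 ?ltW //.
  by rewrite /d exprMn invf_div mulrA.
have cu : (fun n => 1 - d n) @ \oo --> (1 : R).
  by rewrite -[X in _ --> X]subr0; apply: cvgB => //; exact: cvg_cst.
have cv : v @ \oo --> (1 : R).
  have cx : (fun n => 1 - q%:R / (K n)%:R) @ \oo --> (1 : R).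
    rewrite -[X in _ --> X]subr0 -(mulr0 q%:R); apply: cvgB; first exact: cvg_cst.
    apply: cvgMl_tmp; 
    have nK : \forall n \near \oo, (0 : R) < (K n)%:R by exact: nearW.
    exact: (proj2 (gtr0_cvgV0 nK)) hK.
  rewrite -(expr1n R q).
  exact: (continuous_cvg _ (@exprn_continuous R q 1) cx).
(* The bounds for fixed parameters require [d < 1] and [v > 0], which hold for all large [n]. *)
have nd : \forall n \near \oo, d n < 1 by apply: (cvgr_lt 0 cd); rewrite ltr01.
have nv : \forall n \near \oo, 0 < v n by apply: (cvgr_gt 1 cv); rewrite ltr01.
have cV : (fun n => (v n)^-1) @ \oo --> (1 : R) by rewrite -[X in _ --> X]invr1; exact: cvgV (oner_neq0 R) cv.
have cU : (fun n => (1 - d n)^-1) @ \oo --> (1 : R) by rewrite -[X in _ --> X]invr1; exact: cvgV (oner_neq0 R) cu.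
pose rc n := p_compromised R (P n) (K n) q (m n) /
            ((m n)%:R * (K n)%:R / (P n)%:R) ^+ q.
have cc : rc @ \oo --> (1 : R).
  apply: (@squeeze_cvgr _ _ _ _ (fun n => (1 - d n) ^+ 2 * v n)
     (fun n => (1 - d n)^-1 * (v n)^-1)).
  - near=> n; apply: p_compromised_ratio_bounds => //.
      by rewrite -/(d n); near: n.
    by rewrite -/(v n); near: n.
  - rewrite -[X in _ --> X](mulr1 1); apply: cvgM => //.
    by rewrite -[X in _ --> X](mulr1 1); apply: cvgM.
  - by rewrite -[X in _ --> X](mulr1 1); apply: cvgM.
pose rs n := p_s R (P n) (K n) q * q`!%:R / ((K n)%:R ^+ 2 / (P n)%:R) ^+ q.
have cs : rs @ \oo --> (1 : R).
  apply: (@squeeze_cvgr _ _ _ _ (fun n => (1 - d n) * v n ^+ 2) (fun n => (v n)^-1)) => //.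
  (* Although [p_s] does not depend on [m], its error is measured by the same [d], hence the
     explicit [m n]. *)
  - near=> n; apply: (@p_s_ratio_bounds R _ _ _ (m n)) => //.
      by rewrite -/(d n); near: n.
    by rewrite -/(v n); near: n.
  - rewrite -[X in _ --> X](mulr1 1); apply: cvgM => //.
    by rewrite -[X in _ --> X](mulr1 1); apply: cvgM.
split=> //.
have h : (rc \* (fun n => (rs n)^-1)) @ \oo --> (1 * 1^-1 : R).
  exact: cvgM cc (cvgV (oner_neq0 R) cs).
rewrite invr1 mulr1 in h.
(* The second quotient is [rc / rs] term by term: the powers of [P n] cancel. *)
rewrite (_ : (fun n => _) = rc \* (fun n => (rs n)^-1)) //.
apply/funext => n /=.
rewrite /rc /rs; have f0 : (q`!%:R : R) != 0 by rewrite pnatr_eq0 -lt0n fact_gt0.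
have Kn := K0 n; have Pn := P0 n; have Mn := M0 n.
have -> : ((K n)%:R ^+ 2 / (P n)%:R : R) ^+ q = ((K n)%:R ^+ q) ^+ 2 / (P n)%:R ^+ q.
  by rewrite exprMn exprVn exprAC.
(* [p_s] occurs only through its inverse, which is generalised so that [field] does not ask for
   [p_s] to be nonzero. *)
move: (p_s R (P n) (K n) q) => w.
rewrite !exprMn !exprVn !invfM !invrK.
move: w^-1 => w'; field.
by rewrite f0 !gt_eqF // exprn_gt0.
Unshelve. all: end_near.
Qed.
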